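(* Let $\mathbf{v}_0\in\mathbb{R}^d_{\ge0}\setminus\{\mathbf{0}\}$ be fixed, for $u>0$ let $J:=\mathbf{v}_0+u\Delta_d$, and let $f(\mathbf{x}):=\log\left(\frac1d\sum_{j=1}^d e^{x_j}\right)$. Then $$\lim_{u\to\infty}\frac{\operatorname{vol}(P^0(f,J))-\operatorname{vol}(P(f,J))}{\operatorname{vol}(P^0(f,J))}=0.$$
   Context: $\Delta_d:=\{\mathbf{x}\in\mathbb{R}^d_{\ge0}:\sum_{j=1}^d x_j\le1\}$ is the standard $d$-simplex, so $J$ is the $d$-simplex with vertices $\mathbf{v}_0,\mathbf{v}_0+u\mathbf{e}_1,\dots,\mathbf{v}_0+u\mathbf{e}_d$. Let $\mu$ be the unique affine function agreeing with $f$ at the vertices of $J$ and $\mu(\mathbf{x},z):=z\mu(\mathbf{x}/z)$ (extended linearly in $(\mathbf{x},z)$). For $z\ge0$, $z\cdot J:=\{z\mathbf{x}:\mathbf{x}\in J\}$. Perspective relaxation: $P(f,J):=\operatorname{cl}\{(\mathbf{x},y,z)\in\mathbb{R}^d\times\mathbb{R}\times\mathbb{R}:\mu(\mathbf{x},z)\ge y\ge zf(\mathbf{x}/z),\ \mathbf{x}\in z\cdot J,\ 1\ge z>0\}$. Naive relaxation: $P^0(f,J):=\{(\mathbf{x},y,z)\in\mathbb{R}^d\times\mathbb{R}\times\mathbb{R}:\mu(\mathbf{x},z)\ge y\ge f(\mathbf{x}),\ \mathbf{x}\in z\cdot J,\ 1\ge z\ge0\}$. $\operatorname{vol}$ is $(d+2)$-dimensional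 Lebesgue measure. *)

(* Defs.v *)
From HB Require Import structures.
From mathcomp Require Import all_boot all_order all_algebra.
From mathcomp Require Import all_classical all_reals all_analysis.
Set Implicit Arguments. Unset Strict Implicit. Unset Printing Implicit Defensive.
Import Order.TTheory GRing.Theory Num.Theory.
Import numFieldNormedType.Exports.
Local Open Scope classical_set_scope.
Local Open Scope ring_scope.

Section Defs.
Variable R : realType.

Definition box n (a b : 'rV[R]_n) : set 'rV[R]_n :=
  [set x | forall i, a 0 i <= x 0 i /\ x 0 i < b 0 i].
Definition box_vol n (a b : 'rV[R]_n) : \bar R :=
  (\prod_(i < n) Num.max (b 0 i - a 0 i) 0)%:E.
(* Lebesgue outer measure: infimum of the total volume of countable box covers;
   it coincides with the Lebesgue measure on Lebesgue-measurable sets. *)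
Definition leb_vol n (A : set 'rV[R]_n) : \bar R :=
  ereal_inf [set s | exists a b : nat -> 'rV[R]_n,
     A `<=` \bigcup_k box (a k) (b k) /\
     s = (\sum_(0 <= k <oo) box_vol (a k) (b k))%E].

Definition unpack d (p : 'rV[R]_(d.+2)) : 'rV[R]_d * R * R :=
  (\row_(i < d) p 0 (widen_ord (leqnSn d.+1) (widen_ord (leqnSn d) i)),
   p 0 (inord d), p 0 (inord d.+1)).
Definition vol d (S : set ('rV[R]_d * R * R)) : \bar R :=
  leb_vol [set p | S (unpack p)].

Definition simplex (d : nat) : set 'rV[R]_d :=
  [set w | (forall j, 0 <= w 0 j) /\ \sum_(j < d) w 0 j <= 1].
Definition Jset d (v0 : 'rV[R]_d) (u : R) : set 'rV[R]_d :=
  [set v0 + u *: w | w in @simplex d].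
Definition scaleset d (z : R) (J : set 'rV[R]_d) : set 'rV[R]_d :=
  [set z *: w | w in J].
Definition lse d (x : 'rV[R]_d) : R :=
  ln (d%:R^-1 * \sum_(j < d) expR (x 0 j)).
Definition unitv d (j : 'I_d) : 'rV[R]_d := \row_(i < d) (i == j)%:R.
(* slopes of the unique affine function mu agreeing with f at the vertices
   v0, v0 + u e_1, ..., v0 + u e_d of J:
   mu(x) = f(v0) + sum_j a_j (x_j - v0_j),  a_j = (f(v0 + u e_j) - f(v0)) / u *)
Definition mu_slope d (v0 : 'rV[R]_d) (u : R) (j : 'I_d) : R :=
  (lse (v0 + u *: unitv j) - lse v0) / u.
Definition mu d (v0 : 'rV[R]_d) (u : R) (x : 'rV[R]_d) : R :=
  lse v0 + \sum_(j < d) mu_slope v0 u j * (x 0 j - v0 0 j).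
(* perspective mu(x, z) := z mu(x / z), extended linearly *)
Definition mu_persp d (v0 : 'rV[R]_d) (u : R) (x : 'rV[R]_d) (z : R) : R :=
  z * lse v0 + \sum_(j < d) mu_slope v0 u j * (x 0 j - z * v0 0 j).

Definition Ppersp d (v0 : 'rV[R]_d) (u : R) : set ('rV[R]_d * R * R) :=
  closure [set p | let: (x, y, z) := p in
     y <= mu_persp v0 u x z /\ z * lse (z^-1 *: x) <= y /\
     scaleset z (Jset v0 u) x /\ 0 < z /\ z <= 1].
Definition Pnaive d (v0 : 'rV[R]_d) (u : R) : set ('rV[R]_d * R * R) :=
  [set p | let: (x, y, z) := p in
     y <= mu_persp v0 u x z /\ lse x <= y /\
     scaleset z (Jset v0 u) x /\ 0 <= z /\ z <= 1].
End Defs.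

(* Main.v *)
Require Import Defs.
From HB Require Import structures.
From mathcomp Require Import all_boot all_order all_algebra.
From mathcomp Require Import all_classical all_reals all_analysis.
From mathcomp Require Import measurable_realfun ring lra.
Set Implicit Arguments. Unset Strict Implicit. Unset Printing Implicit Defensive.
Import Order.TTheory GRing.Theory Num.Theory.
Import numFieldNormedType.Exports.
Local Open Scope classical_set_scope.
Local Open Scope ring_scope.

(** Since [max x - ln d <= lse x <= max x], and likewise for the perspective
    [z * lse (x / z)] when [0 < z <= 1], the two relaxations differ only inside
    the band [max x - ln d <= y <= max x].  With [x] in a cube of side [O(u)],
    this band has volume [O(u ^ d)].  On the other hand the slopes of [mu] tend
    to [1], so [mu_persp] is close to [\sum_j x_j], and for [d >= 2] the naive
    relaxation contains a box of volume [c * u ^ d.+1].  Hence the ratio is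
    [O(1 / u)].  For [d = 1] the function [lse] is linear and both volumes
    agree.  As [leb_vol] is an outer measure given by box covers, only its
    subadditivity and its value on boxes are used. *)

(** * Outer measure by box covers: its value on boxes and its subadditivity *)

Section BoxVolume.
Variable R : realType.

Lemma lebesgue_measure_co_itv (a b : R) :
  lebesgue_measure (`[a, b[%classic : set R) = (Num.max (b - a) 0)%:E.
Proof.
rewrite lebesgue_measure_itv /= lte_fin; case: ltP => ab.
  by rewrite -EFinB max_l// subr_ge0 ltW.
by rewrite max_r// subr_le0.
Qed.

(* Each slice of the cover along the first coordinate covers the slice of the
   box, so the inequality follows by integrating the one in dimension [n]; the
   predicate [P] selects the boxes met by the slice. *)
Lemma prod_le_cover_sum n (a b : 'I_n -> R) (A B : nat -> 'I_n -> R)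
    (P : pred nat) :
  (forall x : 'I_n -> R, (forall i, a i <= x i < b i) ->
     exists2 k, P k & forall i, A k i <= x i < B k i) ->
  ((\prod_(i < n) Num.max (b i - a i) 0)%:E <=
   \sum_(0 <= k <oo) ((P k)%:R * \prod_(i < n) Num.max (B k i - A k i) 0)%:E)%E.
Proof.
elim: n a b A B P => [|n IH] a b A B P cov.
  (* In dimension 0 all products are empty: the cover yields one selected index, and its term alone
     is 1. *)
  have [|k Pk _] := cov a; first by case.
  rewrite big_ord0.
  apply: (@le_trans _ _ (\sum_(0 <= i < k.+1) ((P i)%:R * 1)%:E)%E).
    by rewrite big_nat_recr//= Pk mulr1 leeDr// sume_ge0// => *; rewrite lee_fin.
  under [leRHS]eq_eseriesr do rewrite big_ord0.
  by apply: nneseries_lim_ge => *; rewrite lee_fin.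
have mco (u v : R) : measurable (`[u, v[%classic : set R) by exact: measurable_itv.
pose I0 := `[a ord0, b ord0[%classic : set R.
pose Ik k := `[A k ord0, B k ord0[%classic : set R.
(* [rest k] times the length of [Ik k] is the volume of the [k]-th box when it is selected, and 0
   otherwise. *)
pose rest k := (P k)%:R *
  \prod_(i < n) Num.max (B k (lift ord0 i) - A k (lift ord0 i)) 0.
have rest0 k : 0 <= rest k.
  by apply: mulr_ge0 => //; apply: prodr_ge0 => i _; rewrite le_max lexx orbT.
set c := \prod_(i < n) Num.max (b (lift ord0 i) - a (lift ord0 i)) 0.
have c0 : 0 <= c by apply: prodr_ge0 => i _; rewrite le_max lexx orbT.
have slice t : I0 t ->
    (c%:E <= \sum_(0 <= k <oo) ((rest k)%:E * (\1_(Ik k) t)%:E))%E.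
  rewrite /I0/= in_itv/= => abt.
  apply: le_trans (IH (a \o lift ord0) (b \o lift ord0)
    (fun k => A k \o lift ord0) (fun k => B k \o lift ord0)
    (fun k => P k && (t \in Ik k)) _) _.
    move=> x xab; pose x' i := if unlift ord0 i is Some j then x j else t.
    have [|k Pk kP] := cov x'.
      by move=> i; rewrite /x'; case: unliftP => [j ->|->]; [exact: xab|].
    exists k; last by move=> i; have := kP (lift ord0 i); rewrite /x' liftK.
    rewrite Pk/= inE /Ik/= in_itv/=.
    by have := kP ord0; rewrite /x' unlift_none.
  apply: lee_nneseries => [k _ _|k _].
    by rewrite lee_fin mulr_ge0//; apply: prodr_ge0 => i _; rewrite le_max lexx orbT.
  rewrite -EFinM lee_fin indicE /rest; case: (P k); rewrite /= ?mul0r//.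
  by rewrite mul1r mulrC.
have mf k : measurable_fun I0 ((fun t => (rest k)%:E * (\1_(Ik k) t)%:E)%E : R -> \bar R).
  apply/measurable_EFinP; apply: measurable_funM => //.
  by apply: measurable_indic; exact: mco.
have f0 k t : I0 t -> (0 <= (rest k)%:E * (\1_(Ik k) t)%:E)%E.
  by move=> _; rewrite -EFinM lee_fin mulr_ge0.
have : (\int[lebesgue_measure]_(t in I0) c%:E <= \int[lebesgue_measure]_(t in I0)
   \sum_(0 <= k <oo) ((rest k)%:E * (\1_(Ik k) t)%:E))%E.
  apply: ge0_le_integral => //; first exact: mco.
  by apply: ge0_emeasurable_sum => [k t /f0//|k _]; exact: mf.
rewrite integral_cst; last exact: mco.
rewrite integral_nneseries//; last exact: mco.
rewrite [X in (_ * X)%E](lebesgue_measure_co_itv (a ord0) (b ord0)).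
rewrite -EFinM big_ord_recl mulrC => /le_trans; apply.
apply: lee_nneseries => [k _ _|k _]; first by apply: integral_ge0 => t /f0.
rewrite ge0_integralZl_EFin//=; last 2 first.
- exact: mco.
- by apply/measurable_EFinP; apply: measurable_indic; exact: mco.
rewrite integral_indic//; try exact: mco.
(* The integral over [I0] only sees the part of [Ik k] inside [I0]; enlarging it to [Ik k] gives the
   full box volume. *)
apply: (@le_trans _ _ ((rest k)%:E * lebesgue_measure (Ik k))%E).
  apply: lee_pmul => //; first by rewrite lee_fin.
  apply: le_measure; rewrite ?inE; [|exact: mco|by move=> ? []].
  by apply: measurableI; exact: mco.
rewrite [X in (_ * X)%E]lebesgue_measure_co_itv -EFinM lee_fin big_ord_recl.
by rewrite /rest -mulrA [X in _ * X <= _]mulrC.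
Qed.

Lemma box_vol_ge0 n (a b : 'rV[R]_n) : (0 <= box_vol a b)%E.
Proof. by rewrite lee_fin; apply: prodr_ge0 => i _; rewrite le_max lexx orbT. Qed.

Lemma leb_vol_ge0 n (S : set 'rV[R]_n) : (0 <= leb_vol S)%E.
Proof.
apply: le_ereal_inf_tmp => s [a [b [_ ->]]].
by apply: nneseries_ge0 => *; exact: box_vol_ge0.
Qed.

Lemma leb_vol_box n (a b : 'rV[R]_n) (S : set 'rV[R]_n) :
  box a b `<=` S -> (box_vol a b <= leb_vol S)%E.
Proof.
move=> abS; apply: le_ereal_inf_tmp => s [A [B [SAB ->]]].
have := @prod_le_cover_sum n (a 0) (b 0) (fun k => A k 0) (fun k => B k 0) xpredT.
under eq_eseriesr do rewrite mul1r.
apply=> x xab.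
have [|k _ kP] := SAB (\row_i x i).
  by apply: abS => i; rewrite mxE; exact/andP.
by exists k => // i; have := kP i; rewrite mxE => /andP.
Qed.

Lemma leb_volS n (S T : set 'rV[R]_n) : S `<=` T -> (leb_vol S <= leb_vol T)%E.
Proof.
move=> ST; apply: le_ereal_inf_tmp => s [A [B [TAB ->]]].
apply: ereal_inf_lbound; exists A, B; split=> //; exact: subset_trans TAB.
Qed.

(** A box volume is finite, so it can be moved across the inequality; any cover of [S] is then
    extended by putting the box at index 0. *)
Lemma leb_volU_box n (S : set 'rV[R]_n) (a b : 'rV[R]_n) :
  (leb_vol (S `|` box a b) <= leb_vol S + box_vol a b)%E.
Proof.
rewrite -leeBlDr//; apply: le_ereal_inf_tmp => s [A [B [SAB ->]]].
rewrite leeBlDr//; apply: ereal_inf_lbound.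
exists (fun k => if k is k'.+1 then A k' else a).
exists (fun k => if k is k'.+1 then B k' else b); split.
  move=> x [/SAB[k _ kP]|xab]; first by exists k.+1.
  by exists 0%N.
rewrite [RHS]nneseries_recl//=; last by case=> *; exact: box_vol_ge0.
rewrite addeC; congr adde; rewrite -(nneseries_addn 1).
  by apply: eq_eseriesr => k _; rewrite addn1.
by case=> *; exact: box_vol_ge0.
Qed.

(** Degenerate boxes have volume 0 only in positive dimension: in dimension 0 the empty product
    gives every box volume 1. *)
Lemma leb_vol_set0 n : leb_vol (set0 : set 'rV[R]_n.+1) = 0%E.
Proof.
apply/eqP; rewrite eq_le leb_vol_ge0 andbT; apply: ereal_inf_lbound.
exists (fun=> 0), (fun=> 0); split=> //.
rewrite eseries0// => k _ _.
by rewrite /box_vol big_ord_recl !mxE subrr maxxx mul0r.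
Qed.

Lemma leb_volU_boxes n (I : eqType) (r : seq I) (a b : I -> 'rV[R]_n)
    (S : set 'rV[R]_n) :
  (leb_vol (S `|` \bigcup_(i in [set i | i \in r]) box (a i) (b i)) <=
   leb_vol S + \sum_(i <- r) box_vol (a i) (b i))%E.
Proof.
elim: r => [|i r IH]; first by rewrite big_nil adde0; apply: leb_volS => x [//|[]//].
rewrite big_cons addeCA addeC.
apply: le_trans (leeD2r _ IH); apply: le_trans (leb_volU_box _ _ _).
apply: leb_volS => x [xS|[j /=]]; first by left; left.
rewrite inE => /predU1P[->|jr] xj; first by right.
by left; right; exists j.
Qed.

End BoxVolume.

(** * Log-sum-exp and its perspective compared with the largest coordinate *)

Section LogSumExp.
Variables (R : realType) (d : nat).
Hypothesis d0 : (0 < d)%N.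
Implicit Types (x : 'rV[R]_d) (M z : R).

Let dR0 : 0 < d%:R :> R. Proof. by rewrite ltr0n. Qed.

Lemma expR_lse x : expR (lse x) = d%:R^-1 * \sum_(j < d) expR (x 0 j).
Proof.
rewrite lnK// posrE mulr_gt0 ?invr_gt0//.
rewrite (bigD1 (Ordinal d0))//= ltr_pwDl ?expR_gt0//.
by apply: sumr_ge0 => *; exact: expR_ge0.
Qed.

Lemma lse_le x M : (forall j, x 0 j <= M) -> lse x <= M.
Proof.
move=> xM; rewrite -ler_expR expR_lse ler_pdivrMl//.
have -> : d%:R * expR M = \sum_(j < d) expR M.
  by rewrite sumr_const card_ord mulr_natl.
by apply: ler_sum => j _; rewrite ler_expR.
Qed.

Lemma lse_ge x M : (forall j, M <= x 0 j) -> M <= lse x.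
Proof.
move=> xM; rewrite -ler_expR expR_lse ler_pdivlMl//.
have -> : d%:R * expR M = \sum_(j < d) expR M.
  by rewrite sumr_const card_ord mulr_natl.
by apply: ler_sum => j _; rewrite ler_expR.
Qed.

(** One exponential is at most the whole sum, and the factor [1 / d] accounts for [- ln d]. *)
Lemma lse_ge_coord x j : x 0 j - ln d%:R <= lse x.
Proof.
rewrite -ler_expR expR_lse expRD expRN lnK ?posrE// mulrC.
rewrite ler_pM2l ?invr_gt0// (bigD1 j)//= lerDl.
by apply: sumr_ge0 => *; exact: expR_ge0.
Qed.

Lemma lse_le_coord x : exists j, lse x <= x 0 j.
Proof.
have [j _ jmax] := @arg_maxP _ _ _ (Ordinal d0) xpredT (x 0) isT.
by exists j; apply: lse_le => i; exact: jmax.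
Qed.

(** Scaling the previous bound replaces [ln d] by [z * ln d], which is at most [ln d]; hence one
    band serves all levels [z]. *)
Lemma persp_lse_ge_coord x z j :
  0 < z -> z <= 1 -> x 0 j - ln d%:R <= z * lse (z^-1 *: x).
Proof.
move=> z0 z1; apply: (@le_trans _ _ (z * ((z^-1 *: x) 0 j - ln d%:R))).
  rewrite mxE mulrBr mulVKf ?gt_eqF// lerB// ler_piMl// ln_ge0//.
  by rewrite (ler_nat _ 1).
by rewrite ler_pM2l// lse_ge_coord.
Qed.

Lemma persp_lse_le_coord x z :
  0 < z -> exists j, z * lse (z^-1 *: x) <= x 0 j.
Proof.
move=> z0; have [j jP] := lse_le_coord (z^-1 *: x); exists j.
rewrite (le_trans (y := z * (z^-1 *: x) 0 j)) ?ler_pM2l//.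
by rewrite mxE mulVKf ?gt_eqF.
Qed.

End LogSumExp.

(** * Splitting the [d + 2] coordinates into [x], [y] and [z] *)

Section Coordinates.
Variables (R : realType) (d : nat).

(** Inverse of [unpack]; [insub] succeeds exactly on the indices below [d]. *)
Definition pack (x : 'I_d -> R) (y z : R) : 'rV[R]_d.+2 :=
  \row_i (if insub (i : nat) is Some j then x j
          else if i == d :> nat then y else z).

Lemma pack_coord x y z (i : 'I_d) :
  pack x y z 0 (widen_ord (leqnSn d.+1) (widen_ord (leqnSn d) i)) = x i.
Proof.
rewrite mxE /= insubT//= => h; congr x; exact/val_inj.
Qed.

Lemma pack_penult x y z : pack x y z 0 (inord d) = y.
Proof. by rewrite mxE inordK ?ltnS// insubF ?ltnn// eqxx. Qed.

Lemma pack_last x y z : pack x y z 0 (inord d.+1) = z.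
Proof. by rewrite mxE inordK// insubF ?ltnNge ?leqnSn// gtn_eqF. Qed.

Lemma prod_pack (F : 'I_d.+2 -> R) :
  \prod_i F i = \prod_(i < d) F (widen_ord (leqnSn d.+1) (widen_ord (leqnSn d) i))
    * F (inord d) * F (inord d.+1).
Proof.
rewrite !big_ord_recr/=; congr (_ * F _ * F _); apply/val_inj => /=.
  by rewrite inordK.
by rewrite inordK.
Qed.

Lemma ord_packP (Q : 'I_d.+2 -> Prop) :
  (forall i : 'I_d, Q (widen_ord (leqnSn d.+1) (widen_ord (leqnSn d) i))) ->
  Q (inord d) -> Q (inord d.+1) -> forall i, Q i.
Proof.
move=> Qx Qy Qz i; have [id|] := ltnP i d.
  have -> : i = widen_ord (leqnSn d.+1) (widen_ord (leqnSn d) (Ordinal id)).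
    exact/val_inj.
  exact: Qx.
rewrite leq_eqVlt => /orP[/eqP di|di].
  by have -> : i = inord d by apply/val_inj; rewrite /= inordK.
have -> // : i = inord d.+1.
apply/val_inj; rewrite /= inordK//; apply/eqP.
by rewrite eqn_leq di andbT -ltnS ltn_ord.
Qed.

Lemma box_packE (xa xb : 'I_d -> R) (ya yb za zb : R) (p : 'rV[R]_d.+2) x y z :
  unpack p = (x, y, z) ->
  box (pack xa ya za) (pack xb yb zb) p <->
  [/\ forall i, xa i <= x 0 i < xb i, ya <= y < yb & za <= z < zb].
Proof.
case=> <- <- <-; split=> [pab|[px /andP py /andP pz]].
  split=> [i||]; apply/andP.
  - by rewrite mxE; have := pab (widen_ord (leqnSn d.+1) (widen_ord (leqnSn d) i));
    rewrite !pack_coord.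
  - by have := pab (inord d); rewrite !pack_penult.
  - by have := pab (inord d.+1); rewrite !pack_last.
apply: ord_packP => [i||]; rewrite ?pack_coord ?pack_penult ?pack_last//.
by have /andP := px i; rewrite mxE.
Qed.

Lemma box_vol_pack (xa xb : 'I_d -> R) (ya yb za zb : R) :
  box_vol (pack xa ya za) (pack xb yb zb) =
  (\prod_(i < d) Num.max (xb i - xa i) 0 * Num.max (yb - ya) 0
     * Num.max (zb - za) 0)%:E.
Proof.
rewrite /box_vol prod_pack !pack_penult !pack_last.
by under eq_bigr do rewrite !pack_coord.
Qed.

Lemma volS (S T : set ('rV[R]_d * R * R)) : S `<=` T -> (vol S <= vol T)%E.
Proof. by move=> ST; apply: leb_volS => p /ST. Qed.

End Coordinates.

(** The set where [g - f] is nonnegative is closed and contains [S]. *)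
Lemma closure_le_fun (R : realType) (T : topologicalType) (S : set T) (f g : T -> R) :
  continuous f -> continuous g -> (forall p, S p -> f p <= g p) ->
  forall p, closure S p -> f p <= g p.
Proof.
move=> cf cg fg p clp; rewrite -subr_ge0.
have cl : closed ((fun q => g q - f q) @^-1` [set r | 0 <= r]).
  apply: preimage_closed; last exact: closed_ge.
  by move=> q _; apply: cvgB; [exact: cg|exact: cf].
by apply: cl; apply: closureS clp => q /fg; rewrite /= subr_ge0.
Qed.

(** * The two relaxations agree outside a band *)

Section Relaxations.
Variables (R : realType) (d : nat) (v0 : 'rV[R]_d) (u : R).
Hypotheses (d0 : (0 < d)%N) (v0_ge0 : forall j, 0 <= v0 0 j) (u0 : 0 < u).
Implicit Types (x : 'rV[R]_d) (y z : R) (p : 'rV[R]_d * R * R).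

(** For [z > 0], solving [x = z (v0 + u w)] for [w] turns the simplex constraints into these
    inequalities. For [z = 0] they force [x = 0]. *)
Lemma scaleset_JsetP x z : 0 <= z ->
  scaleset z (Jset v0 u) x <->
  (forall j, z * v0 0 j <= x 0 j) /\ \sum_j (x 0 j - z * v0 0 j) <= z * u.
Proof.
move=> z0; split.
  move=> [_ [w [w0 w1] <-] <-]; split=> [j|].
    by rewrite !mxE mulrDr lerDl !mulr_ge0// ltW.
  under eq_bigr do rewrite !mxE mulrDr addrAC subrr add0r mulrA.
  by rewrite -mulr_sumr ler_piMr// mulr_ge0// ltW.
move=> [xv xu]; move: z0; rewrite le_eqVlt => /predU1P[z0|z0].
  rewrite -z0 in xv xu *.
  have x0 j : 0 <= x 0 j by rewrite -(mul0r (v0 0 j)).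
  have : \sum_j x 0 j == 0.
    rewrite eq_le sumr_ge0// andbT -[leRHS](mul0r u); apply: le_trans xu.
    by apply: ler_sum => j _; rewrite mul0r subr0.
  rewrite psumr_eq0// => /allP xE.
  exists v0; last first.
    apply/rowP => j; rewrite !mxE mul0r; apply/esym/eqP.
    by have := xE j; rewrite mem_index_enum => /(_ isT).
  exists 0; last by rewrite scaler0 addr0.
  by split=> [j|]; rewrite ?mxE// big1// => j _; rewrite mxE.
have zu : z * u != 0 by rewrite mulf_neq0// gt_eqF.
exists (z^-1 *: x); last by rewrite scalerA divff ?gt_eqF// scale1r.
exists ((z * u)^-1 *: (x - z *: v0)).
  split=> [j|].
    by rewrite !mxE mulr_ge0// ?subr_ge0// invr_ge0 mulr_ge0// ltW.
  under eq_bigr do rewrite !mxE.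
  by rewrite -mulr_sumr ler_pdivrMl ?mulr1// mulr_gt0.
apply/rowP => j; rewrite !mxE.
by field; rewrite !gt_eqF.
Qed.

(* The constraints are closed, so they pass to the closure in [Ppersp]. *)
Definition outer p :=
  let: (x, y, z) := p in
  [/\ y <= mu_persp v0 u x z, forall j, x 0 j - ln d%:R <= y,
      forall j, z * v0 0 j <= x 0 j, \sum_j (x 0 j - z * v0 0 j) <= z * u
    & 0 <= z <= 1].

Lemma Pnaive_outer p : Pnaive v0 u p -> outer p.
Proof.
case: p => [[x y] z] [ymu [xy [xJ [z0 z1]]]].
have [xv xu] := (scaleset_JsetP x z0).1 xJ.
split=> //; last by rewrite z0 z1.
by move=> j; apply: le_trans xy; exact: lse_ge_coord.
Qed.

Lemma Ppersp_outer p : Ppersp v0 u p -> outer p.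
Proof.
have cx j : continuous (fun q : 'rV[R]_d * R * R => q.1.1 0 j).
  move=> q; apply: (@continuous_comp _ _ _ (fun q : 'rV[R]_d * R * R => q.1.1)
    (fun x : 'rV[R]_d => x 0 j)); last exact: coord_continuous.
  by apply: (@continuous_comp _ _ _ fst fst); exact: cvg_fst.
have cy : continuous (fun q : 'rV[R]_d * R * R => q.1.2).
  move=> q; apply: (@continuous_comp _ _ _ fst snd); [exact: cvg_fst|exact: cvg_snd].
have cz : continuous (fun q : 'rV[R]_d * R * R => q.2) by move=> q; exact: cvg_snd.
have cxv j : continuous (fun q : 'rV[R]_d * R * R => q.1.1 0 j - q.2 * v0 0 j).
  move=> q; apply: cvgB; first exact: cx.
  by apply: cvgM; [exact: cz|exact: cvg_cst].
have SP q : (let: (x, y, z) := q in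
     y <= mu_persp v0 u x z /\ z * lse (z^-1 *: x) <= y /\
     scaleset z (Jset v0 u) x /\ 0 < z /\ z <= 1) -> outer q.
  case: q => [[x y] z] [ymu [xy [xJ [z0 z1]]]].
  have [xv xu] := (scaleset_JsetP x (ltW z0)).1 xJ.
  split=> //; last by rewrite (ltW z0) z1.
  by move=> j; apply: le_trans xy; exact: persp_lse_ge_coord.
case: p => [[x y] z] clp; split.
- apply: (@closure_le_fun _ _ _ (fun q : 'rV[R]_d * R * R => q.1.2)
    (fun q => mu_persp v0 u q.1.1 q.2) _ _ _ _ clp) => //.
    move=> q; apply: cvgD; first by apply: cvgM; [exact: cz|exact: cvg_cst].
    apply: cvg_big => [|j _]; first exact: add_continuous.
    by apply: cvgM; [exact: cvg_cst|exact: cxv].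
  by move=> [[x' y'] z'] h; have [] := SP (x', y', z') h.
- move=> j.
  apply: (@closure_le_fun _ _ _ (fun q : 'rV[R]_d * R * R => q.1.1 0 j - ln d%:R)
    (fun q => q.1.2) _ _ _ _ clp) => //.
    by move=> q; apply: cvgB; [exact: cx|exact: cvg_cst].
  by move=> [[x' y'] z'] h; have [] := SP (x', y', z') h.
- move=> j.
  apply: (@closure_le_fun _ _ _ (fun q : 'rV[R]_d * R * R => q.2 * v0 0 j)
    (fun q => q.1.1 0 j) _ _ _ _ clp) => //.
    by move=> q; apply: cvgM; [exact: cz|exact: cvg_cst].
  by move=> [[x' y'] z'] h; have [] := SP (x', y', z') h.
- apply: (@closure_le_fun _ _ _ (fun q : 'rV[R]_d * R * R =>
      \sum_j (q.1.1 0 j - q.2 * v0 0 j)) (fun q => q.2 * u) _ _ _ _ clp) => //.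
  + move=> q; apply: cvg_big => [|j _]; first exact: add_continuous.
    exact: cxv.
  + by move=> q; apply: cvgM; [exact: cz|exact: cvg_cst].
  + by move=> [[x' y'] z'] h; have [] := SP (x', y', z') h.
- apply/andP; split.
    apply: (@closure_le_fun _ _ _ (fun=> 0) (fun q : 'rV[R]_d * R * R => q.2)
      _ _ _ _ clp) => //; first by move=> q; exact: cvg_cst.
    by move=> [[x' y'] z'] h; have [_ _ _ _ /andP[]] := SP (x', y', z') h.
  apply: (@closure_le_fun _ _ _ (fun q : 'rV[R]_d * R * R => q.2) (fun=> 1)
    _ _ _ _ clp) => //; first by move=> q; exact: cvg_cst.
  by move=> [[x' y'] z'] h; have [_ _ _ _ /andP[]] := SP (x', y', z') h.
Qed.

(** Inside [outer], for [z > 0], a relaxation can only be missed by violating its lower bound on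
    [y]. *)
Lemma outer_Pnaive x y z : outer (x, y, z) -> lse x <= y -> Pnaive v0 u (x, y, z).
Proof.
by move=> [ymu _ xv xu /andP[z0 z1]] xy; do !split => //; apply/scaleset_JsetP.
Qed.

Lemma outer_Ppersp x y z : outer (x, y, z) -> 0 < z ->
  z * lse (z^-1 *: x) <= y -> Ppersp v0 u (x, y, z).
Proof.
move=> [ymu _ xv xu /andP[_ z1]] z0 xy; apply: subset_closure.
by do !split => //; apply/scaleset_JsetP => //; exact: ltW.
Qed.

Lemma outer_apex x y : outer (x, y, 0) -> x = 0 /\ y <= 0.
Proof.
move=> [ymu _ xv xu _].
have [w _ wx] : scaleset 0 (Jset v0 u) x by apply/scaleset_JsetP.
have x0 : x = 0 by rewrite -wx scale0r.
split=> //; apply: le_trans ymu _.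
rewrite /mu_persp mul0r add0r big1// => j _.
by rewrite x0 mxE mul0r subrr mulr0.
Qed.

(** The second and third clauses say that [y] lies between [max x - ln d] and [max x]. *)
Definition band (K : R) p :=
  let: (x, y, z) := p in
  [/\ forall j, 0 <= x 0 j <= K, forall j, x 0 j - ln d%:R <= y,
      exists j, y <= x 0 j & 0 <= z <= 1].

Lemma outer_coord_bounds x y z j : outer (x, y, z) ->
  0 <= x 0 j - z * v0 0 j <= u /\ 0 <= x 0 j <= u + \sum_i v0 0 i.
Proof.
move=> [_ _ xv xu /andP[z0 z1]].
have xvj0 : 0 <= x 0 j - z * v0 0 j by rewrite subr_ge0.
have xvju : x 0 j - z * v0 0 j <= u.
  apply: (@le_trans _ _ (\sum_i (x 0 i - z * v0 0 i))).
    rewrite (bigD1 j)//= lerDl; apply: sumr_ge0 => i _; by rewrite subr_ge0.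
  by apply: le_trans xu _; rewrite ler_piMl// ltW.
have vs : v0 0 j <= \sum_i v0 0 i.
  by rewrite (bigD1 j)//= lerDl; apply: sumr_ge0 => i _.
have zv : 0 <= z * v0 0 j by rewrite mulr_ge0.
have zv' : z * v0 0 j <= v0 0 j by rewrite ler_piMl.
by split; apply/andP; split=> //; lra.
Qed.

Lemma outer_band x y z j :
  outer (x, y, z) -> y <= x 0 j -> band (u + \sum_i v0 0 i) (x, y, z).
Proof.
move=> o yx; have [_ xy _ _ z01] := o; split=> //; last by exists j.
by move=> i; have [] := outer_coord_bounds i o.
Qed.

Lemma Pnaive_sub_band p :
  Pnaive v0 u p -> Ppersp v0 u p \/ band (u + \sum_i v0 0 i) p.
Proof.
move=> np; have := Pnaive_outer np; case: p np => [[x y] z] np o.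
have [_ _ _ _ /andP[]] := o; rewrite le_eqVlt => /predU1P[z0 _|z0 _].
  (* At [z = 0] the formula [z * lse (x / z)] says nothing about the closure, so the apex is placed
     in the band directly: there [y <= 0 = x_j]. *)
  rewrite -z0 in o *; right.
  have [x0 y0] := outer_apex o; apply: (outer_band (j := Ordinal d0) o).
  by rewrite x0 mxE.
have [xy|/ltW yx] := leP (z * lse (z^-1 *: x)) y.
  by left; exact: outer_Ppersp.
right; have [j jP] := persp_lse_le_coord d0 x z0.
by apply: (outer_band (j := j) o); exact: le_trans jP.
Qed.

Lemma Ppersp_sub_band p :
  Ppersp v0 u p -> Pnaive v0 u p \/ band (u + \sum_i v0 0 i) p.
Proof.
move=> /Ppersp_outer; case: p => [[x y] z] o.
have [xy|/ltW yx] := leP (lse x) y; first by left; exact: outer_Pnaive.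
right; have [j jP] := lse_le_coord d0 x.
by apply: (outer_band (j := j) o); exact: le_trans jP.
Qed.

(** [outer] is bounded. Finiteness matters because [fine] sends [+oo] to 0. *)
Lemma vol_outer_lty (S : set ('rV[R]_d * R * R)) :
  (forall p, S p -> outer p) -> (vol S < +oo)%E.
Proof.
move=> So; set K := u + \sum_i v0 0 i.
(* [Y] bounds [mu_persp], since [z] lies in [[0, 1]] and each [x_j - z v0_j] in [[0, u]]. The upper
   corner below is enlarged because boxes are half-open. *)
set Y := `|lse v0| + \sum_j `|mu_slope v0 u j| * u.
pose a := pack (fun=> 0) (- ln d%:R) 0 : 'rV[R]_d.+2.
pose b := pack (fun=> K + 1) (Y + 1) 2 : 'rV[R]_d.+2.
have : (vol S <= leb_vol (set0 : set 'rV[R]_d.+2) + box_vol a b)%E.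
  apply: le_trans _ (leb_volU_box _ _ _); apply: leb_volS => p /So.
  case pE: (unpack p) => [[x y] z] o; right; apply/(box_packE _ _ _ _ _ _ pE).
  have [ymu xy _ _ /andP[z0 z1]] := o.
  have xb j := outer_coord_bounds j o.
  split.
  - move=> i; have [_ /andP[h0 h]] := xb i.
    by apply/andP; split=> //; rewrite (le_lt_trans h)// ltrDl.
  - apply/andP; split.
      apply: le_trans (xy (Ordinal d0)); rewrite lerDr.
      by have [_ /andP[]] := xb (Ordinal d0).
    rewrite (@le_lt_trans _ _ Y) ?ltrDl//; apply: le_trans ymu _.
    apply: lerD.
      by rewrite (le_trans (ler_norm _))// normrM (ger0_norm z0) ler_piMl.
    apply: ler_sum => j _; have [/andP[h1 h2] _] := xb j.
    rewrite (le_trans (ler_norm _))// normrM (ger0_norm h1).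
    by rewrite ler_wpM2l.
  - by rewrite z0 (le_lt_trans z1)// ltr1n.
by rewrite leb_vol_set0 add0e => /le_lt_trans; apply; rewrite ltry.
Qed.

End Relaxations.

(** * Upper bound for the band, lower bound for the naive relaxation *)

Section Volumes.
Variables (R : realType) (d : nat) (v0 : 'rV[R]_d).
Hypotheses (d0 : (0 < d)%N) (v0_ge0 : forall j, 0 <= v0 0 j).

Let L0 : 0 <= ln d%:R :> R. Proof. by rewrite ln_ge0// (ler_nat _ 1). Qed.

(* Over each unit cube of the [x]-space, [y] ranges over an interval of length
   [ln d + 1] around the largest lower-corner coordinate. *)
Lemma vol_setU_band_le (S : set ('rV[R]_d * R * R)) (K : R) (N : nat) :
  K < N%:R ->
  (vol (S `|` band K) <= vol S + (N%:R ^+ d * ((ln d%:R + 1) * 2))%:E)%E.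
Proof.
(* [k] is the integer lower corner of a unit cube. Each of the [N ^ d] boxes has [y]-length
   [ln d + 1] and [z]-length 2, as [[0, 2[] covers [[0, 1]]. *)
move=> KN; pose m (k : {ffun 'I_d -> 'I_N}) := (\max_i (k i : nat))%N.
pose a (k : {ffun 'I_d -> 'I_N}) := pack (fun i => (k i)%:R) ((m k)%:R - ln d%:R) 0
  : 'rV[R]_d.+2.
pose b (k : {ffun 'I_d -> 'I_N}) := pack (fun i => (k i)%:R + 1) ((m k)%:R + 1) 2
  : 'rV[R]_d.+2.
have -> : (N%:R ^+ d * ((ln d%:R + 1) * 2))%:E =
    (\sum_(k : {ffun 'I_d -> 'I_N}) box_vol (a k) (b k))%E.
  under eq_bigr => k _.
    rewrite box_vol_pack big1; last first.
      by move=> i _; rewrite addrAC subrr add0r max_l.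
    rewrite subr0 (max_l (_ : 0 <= 2))//.
    have -> : (m k)%:R + 1 - ((m k)%:R - ln d%:R) = ln d%:R + 1 :> R by ring.
    rewrite max_l ?addr_ge0// mul1r.
    over.
  rewrite sumEFin sumr_const card_ffun !card_ord.
  by rewrite -natrX mulr_natl.
apply: le_trans (leb_volU_boxes _ _ _ _); apply: leb_volS => p [Sp|]; first by left.
case pE: (unpack p) => [[x y] z] [xK xy [j0 yx] /andP[z0 z1]].
have xN (i : 'I_d) : (Num.truncn (x 0%R i) < N)%N.
  have /andP[x0 xk] := xK i.
  by rewrite -(ltr_nat R) (le_lt_trans _ KN)// (le_trans _ xk)// truncn_le.
pose k := [ffun i => Ordinal (xN i)].
have kx i : (k i)%:R <= x 0 i < (k i)%:R + 1.
  have /andP[x0 _] := xK i.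
  by have := truncn_itv x0; rewrite ffunE/= natr1.
right; exists k; first by rewrite /= mem_index_enum.
apply/(box_packE _ _ _ _ _ _ pE); split=> //.
  apply/andP; split.
    (* The lower bound on [y] uses a coordinate attaining [m k]; the upper one uses [j0], where [x]
       is below [k j0 + 1]. *)
    have [|j mj] := @bigop.eq_bigmax _ (fun i => k i : nat); first by rewrite card_ord.
    by rewrite /m mj (le_trans _ (xy j))// lerB//; have /andP[] := kx j.
  apply: le_lt_trans yx _; have /andP[_ /lt_le_trans] := kx j0; apply.
  by rewrite lerD2r ler_nat (leq_bigmax j0).
by rewrite z0 (le_lt_trans z1)// ltr1n.
Qed.

(** The [j]-th coordinate of [v0 + u e_j] is at least [u], and the sum of [v0] crudely bounds its
    largest coordinate, hence [lse v0]. *)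
Lemma mu_slope_ge u j : 0 < u -> (u - ln d%:R - \sum_i v0 0 i) / u <= mu_slope v0 u j.
Proof.
move=> u0; rewrite ler_pM2r ?invr_gt0//; apply: lerB.
  apply: le_trans (lse_ge_coord d0 _ j).
  by rewrite !mxE eqxx mulr1 lerB// lerDr.
apply: lse_le => // i.
by rewrite (bigD1 i)//= lerDl; apply: sumr_ge0.
Qed.

Lemma vol_Pnaive_ge u : (1 < d)%N -> 0 < u ->
  64 * (ln d%:R + \sum_i v0 0 i) <= u / d%:R ->
  ((u ^+ d.+1 / (16 * d%:R) ^+ d / 64)%:E <= vol (Pnaive v0 u))%E.
Proof.
move=> d1 u0; set t := u / d%:R; set V := \sum_i v0 0 i => Vt.
have dR0 : 0 < d%:R :> R by rewrite ltr0n.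
have t0 : 0 < t by rewrite divr_gt0.
have dt : t *+ d = u by rewrite -mulr_natr mulfVK ?gt_eqF.
have V0 : 0 <= V by apply: sumr_ge0.
have vV j : v0 0 j <= V by rewrite /V (bigD1 j)//= lerDl; apply: sumr_ge0.
(* Here [d >= 2] enters: it makes [x_j < t / 4 <= u / 8 <= y] on the box below. *)
have tu : t <= u / 2 by rewrite ler_pM2l// lef_pV2 ?posrE// (ler_nat _ 2).
have sumt (c : R) : \sum_(j < d) t * c = u * c.
  by rewrite sumr_const card_ord -mulrnAl dt.
(* On this box [\sum_j x_j] lies between [3 u / 16] and [u / 4 <= z u]. With slopes at least
   [15/16], [mu_persp] is at least [45 u / 256] minus a multiple of [V], which stays above
   [5 u / 32 = 40 u / 256]. *)
pose a := pack (fun=> t * (3/16)) (u * (1/8)) (1/2) : 'rV[R]_d.+2.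
pose b := pack (fun=> t * (1/4)) (u * (5/32)) 1 : 'rV[R]_d.+2.
have -> : (u ^+ d.+1 / (16 * d%:R) ^+ d / 64)%:E = box_vol a b.
  rewrite box_vol_pack prodr_const card_ord -!mulrBr.
  rewrite !max_l; [|lra|lra|lra]; congr EFin.
  have -> : t * (1 / 4 - 3 / 16) = u / (16 * d%:R).
    by rewrite /t; field; rewrite gt_eqF.
  by rewrite expr_div_n exprSr; field; rewrite expf_neq0// mulf_neq0// gt_eqF.
apply: leb_vol_box => p; case pE: (unpack p) => [[x y] z].
move=> /(box_packE _ _ _ _ _ _ pE)[xt /andP[ya yb] /andP[za zb]].
suff : Pnaive v0 u (x, y, z) by rewrite -pE.
have {}xt j : t * (3/16) <= x 0 j < t * (1/4) by exact: xt.
have z0 : 0 < z by lra.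
have zv j : 0 <= z * v0 0 j <= V.
  apply/andP; split; first by rewrite mulr_ge0// ltW.
  by rewrite (le_trans _ (vV j))// ler_piMl// ltW.
have zvV : \sum_j z * v0 0 j <= V by rewrite -mulr_sumr ler_piMl// ltW.
have xlo : u * (3/16) <= \sum_j x 0 j.
  by rewrite -sumt; apply: ler_sum => j _; have /andP[] := xt j.
have xhi : \sum_j x 0 j <= u * (1/4).
  by rewrite -sumt; apply: ler_sum => j _; have /andP[_ /ltW] := xt j.
have zx j : z * v0 0 j <= x 0 j.
  by have /andP[? _] := xt j; have /andP[_ ?] := zv j; have := L0; lra.
have slope j : 15/16 <= mu_slope v0 u j.
  apply: le_trans (mu_slope_ge j u0); rewrite ler_pdivlMr//.
  by rewrite -/V; lra.
split; last split; last split; last by split; lra.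
- apply: (@le_trans _ _ (15/16 * \sum_j (x 0 j - z * v0 0 j))).
    by rewrite sumrB; have := L0; lra.
  rewrite /mu_persp -[leLHS]add0r lerD//.
    by rewrite mulr_ge0 ?(ltW z0)//; apply: lse_ge.
  by rewrite mulr_sumr; apply: ler_sum => j _; rewrite ler_wpM2r// subr_ge0.
- apply: lse_le => // j; have /andP[_ ?] := xt j; lra.
apply/scaleset_JsetP => //; first exact: ltW.
split=> //; rewrite sumrB.
have : 0 <= \sum_j z * v0 0 j by apply: sumr_ge0 => j _; have /andP[] := zv j.
have : u * (1/2) <= z * u by rewrite mulrC ler_pM2r.
lra.
Qed.

End Volumes.

(** * Dimension one: equal volumes *)

Section DimensionOne.
Variables (R : realType) (v0 : 'rV[R]_1) (u : R).
Hypotheses (v0_ge0 : forall j, 0 <= v0 0 j) (u0 : 0 < u).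

Lemma lse1 (x : 'rV[R]_1) : lse x = x 0 0.
Proof.
apply/eqP; rewrite eq_le; apply/andP; split.
  by apply: lse_le => // j; rewrite ord1.
by apply: le_trans (lse_ge_coord _ x 0); rewrite ?ln1 ?subr0.
Qed.

(** Since [lse] is the identity, the slope is 1 and [ln 1 = 0]: the upper and lower bounds on [y]
    coincide. *)
Lemma outer1 (x : 'rV[R]_1) y z : outer v0 u (x, y, z) -> y = x 0 0.
Proof.
move=> [ymu xy _ _ _]; apply/eqP; rewrite eq_le; apply/andP; split; last first.
  by have := xy 0; rewrite ln1 subr0.
apply: le_trans ymu _; rewrite /mu_persp /mu_slope big_ord1 !lse1 !mxE eqxx mulr1.
by rewrite addrAC subrr add0r divff ?gt_eqF// mul1r addrC subrK.
Qed.

(** One inclusion is direct. Conversely, points with [z > 0] are shared, and the apex is absorbed by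
    a box of arbitrarily small volume [e]. *)
Lemma vol_Pnaive_Ppersp1 : vol (Pnaive v0 u) = vol (Ppersp v0 u).
Proof.
apply/eqP; rewrite eq_le; apply/andP; split; last first.
  apply: volS => -[[x y] z] h.
  have o : outer v0 u (x, y, z) by exact: Ppersp_outer.
  by apply: outer_Pnaive => //; rewrite lse1 (outer1 o).
apply/lee_addgt0Pr => e e0.
pose a := pack (fun=> 0) 0 0 : 'rV[R]_3; pose b := pack (fun=> 1) 1 e : 'rV[R]_3.
have -> : e%:E = box_vol a b.
  by rewrite box_vol_pack big_ord1 !subr0 !max_l ?ler01 ?(ltW e0)// !mul1r.
apply: le_trans (leb_volU_box _ _ _); apply: leb_volS => p np.
case pE: (unpack p) => [[x y] z].
have o : outer v0 u (x, y, z) by rewrite -pE; exact: Pnaive_outer.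
have yx := outer1 o; have [_ _ _ _ /andP[]] := o.
rewrite le_eqVlt => /predU1P[z0 _|z0 _]; last first.
  left; suff : Ppersp v0 u (x, y, z) by rewrite -pE.
  apply: outer_Ppersp => //.
  by rewrite lse1 mxE yx mulVKf ?gt_eqF.
right; apply/(box_packE _ _ _ _ _ _ pE).
rewrite -z0 in o *; have [x0 _] : x = 0 /\ y <= 0 by exact: outer_apex o.
by rewrite yx x0; split=> [i||]; rewrite ?mxE ?lexx ?ltr01.
Qed.

End DimensionOne.

(** * Finiteness of the volumes and the limit of their relative gap *)

Theorem theorem16 (R : realType) (d : nat) (v0 : 'rV[R]_d) :
  (0 < d)%N -> (forall j, 0 <= v0 0 j) -> v0 != 0 ->
  (forall u : R, 0 < u ->
     (vol (Pnaive v0 u) < +oo)%E /\ (vol (Ppersp v0 u) < +oo)%E) /\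
  ((fine (vol (Pnaive v0 u)) - fine (vol (Ppersp v0 u)))
      / fine (vol (Pnaive v0 u)) @[u --> +oo] --> 0).
Proof.
move=> d0 v0_ge0 _.
have finv u : 0 < u ->
     (vol (Pnaive v0 u) < +oo)%E /\ (vol (Ppersp v0 u) < +oo)%E.
  move=> u0; split; apply: (@vol_outer_lty _ _ v0 u) => // p.
    exact: Pnaive_outer.
  exact: Ppersp_outer.
split=> //; apply/cvgr0Pnorm_lt => e e0.
have [d1|] := ltnP 1 d; last first.
  rewrite leq_eqVlt ltnS leqNgt d0 orbF => /eqP d1; subst d.
  near=> u; rewrite vol_Pnaive_Ppersp1//.
  by rewrite subrr mul0r normr0.
set L : R := ln d%:R; set V := \sum_i v0 0 i.
(* [C / u] is the quotient of the band bound, with [N] replaced by [2 u], by the lower bound on the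
   naive volume. *)
pose C : R := (32 * d%:R) ^+ d * 128 * (L + 1).
have dR0 : 0 < d%:R :> R by rewrite ltr0n.
near=> u.
have u0 : 0 < u by near: u; exact: nbhs_pinfty_gt.
(* This makes the rounded-up cube side at most [u + V + 1 <= 2 u]. *)
have uV : V + 1 <= u by near: u; apply: nbhs_pinfty_ge; rewrite num_real.
have uL : 64 * (L + V) <= u / d%:R.
  by rewrite ler_pdivlMr//; near: u; apply: nbhs_pinfty_ge; rewrite num_real.
have uC : C / e < u by near: u; apply: nbhs_pinfty_gt; rewrite num_real.
have [nfin pfin] := finv u u0.
have lo := vol_Pnaive_ge d0 v0_ge0 d1 u0 uL.
have uV0 : 0 <= u + V by rewrite addr_ge0 ?(ltW u0)// sumr_ge0.
have [N uN Nu] : exists2 N : nat, u + V < N%:R & N%:R <= 2 * u.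
  exists (Num.truncn (u + V)).+1.
    by have /andP[] := truncn_itv uV0.
  by have /andP[tr _] := truncn_itv uV0; rewrite -natr1; lra.
pose D : R := N%:R ^+ d * ((L + 1) * 2).
have hiN : (vol (Pnaive v0 u) <= vol (Ppersp v0 u) + D%:E)%E.
  apply: le_trans (vol_setU_band_le d0 _ uN); apply: volS => p.
  exact: Pnaive_sub_band.
have hiP : (vol (Ppersp v0 u) <= vol (Pnaive v0 u) + D%:E)%E.
  apply: le_trans (vol_setU_band_le d0 _ uN); apply: volS => p.
  exact: Ppersp_sub_band.
move: lo hiN hiP nfin pfin.
have := leb_vol_ge0 [set p | Pnaive v0 u (unpack p)].
have := leb_vol_ge0 [set p | Ppersp v0 u (unpack p)].
rewrite -/(vol _) -/(vol _).
case: (vol (Pnaive v0 u)) => // n; case: (vol (Ppersp v0 u)) => // q.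
rewrite /= -!EFinD !lee_fin => _ _ lo hiN hiP _ _.
have L0 : 0 <= L by rewrite ln_ge0// (ler_nat _ 1).
have n0 : 0 < n.
  by apply: lt_le_trans lo; rewrite !divr_gt0// exprn_gt0// mulr_gt0.
rewrite normrM normfV (gtr0_norm n0) ltr_pdivrMr//.
(* The two band inclusions bound the gap of the volumes by [D] in both directions. *)
apply: (@le_lt_trans _ _ D); first by rewrite ler_norml; apply/andP; split; lra.
apply: (@le_lt_trans _ _ ((2 * u) ^+ d * ((L + 1) * 2))).
  rewrite ler_wpM2r ?mulr_ge0 ?addr_ge0//.
  by rewrite lerXn2r// nnegrE// mulr_ge0// ltW.
apply: (@lt_le_trans _ _ (e * (u ^+ d.+1 / (16 * d%:R) ^+ d / 64))); last first.
  by rewrite ler_pM2l.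
rewrite ltr_pdivrMr// in uC.
(* Both sides are multiples of the same positive factor, which leaves [C < u * e]. *)
have -> : (2 * u) ^+ d * ((L + 1) * 2) = C * (u ^+ d / (16 * d%:R) ^+ d / 64).
  rewrite /C (_ : 32 * d%:R = 2 * (16 * d%:R)); last by ring.
  rewrite [in RHS]exprMn [in LHS]exprMn; field.
  by rewrite expf_neq0// mulf_neq0// gt_eqF.
have -> : e * (u ^+ d.+1 / (16 * d%:R) ^+ d / 64) =
    u * e * (u ^+ d / (16 * d%:R) ^+ d / 64) by rewrite exprS; ring.
rewrite ltr_pM2r//.
by rewrite !divr_gt0// exprn_gt0// mulr_gt0.
Unshelve. all: by end_near.
Qed.
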